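(* Let $\mathcal K$ and $\varpi(\cdot)$ be as in the context, $U\in\mathbb S^n_{\succ0}$, and let $\boldsymbol f(\cdot)\in\mathcal L^2_\varpi(\mathcal K;\mathbb R^d)$ satisfy $\int_{\mathcal K}\varpi(\tau)\boldsymbol f(\tau)\boldsymbol f^\top(\tau)d\tau\succ0$; put $F(\tau)=\boldsymbol f(\tau)\otimes I_n$. Let $\rho\in\mathbb N$. For any $Y\in\mathbb S^{\rho dn}$ and $X=[X_1\ \cdots\ X_d]\in\mathbb R^{n\times\rho dn}$ (blocks $X_i\in\mathbb R^{n\times\rho n}$) satisfying $$\begin{bmatrix}U&-X\\ -X^\top&Y\end{bmatrix}\succeq0,$$ and for all $\boldsymbol x(\cdot)\in\mathcal L^2_\varpi(\mathcal K;\mathbb R^n)$, $$\int_{\mathcal K}\varpi(\tau)\boldsymbol x^\top(\tau)U\boldsymbol x(\tau)d\tau\ \ge\ \boldsymbol z^\top\left[\mathsf{Sy}(\Upsilon^\top\widehat X)-\mathsf W\right]\boldsymbol z,$$ where $\mathsf W=\int_{\mathcal K}\varpi(\tau)(\boldsymbol f^\top(\tau)\otimes I_{\rho n})Y(\boldsymbol f(\tau)\otimes I_{\rho n})d\tau\in\mathbb S^{\rho n}$, $\widehat X\in\mathbb R^{dn\times\rho n}$ is the vertical stacking of $X_1,\dots,X_d$, and $\Upsilon\in\mathbb R^{dn\times\rho n}$, $\boldsymbol z\in\mathbb R^{\rho n}$ satisfy $\Upsilon\boldsymbol z=\int_{\mathcal K}\varpi(\tau)F(\tau)\boldsymbol 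x(\tau)d\tau$.
   Context: $\mathcal K\subseteq\mathbb R\cup\{\pm\infty\}$ has nonzero Lebesgue measure; $\varpi:\mathcal K\to\mathbb R_{\ge0}$ is measurable with only finitely or countably infinitely many zeros. $\mathcal L^2_\varpi(\mathcal K;\mathbb R^d)$ is the set of measurable $\boldsymbol\phi:\mathcal K\to\mathbb R^d$ with $\int_{\mathcal K}\varpi\boldsymbol\phi^\top\boldsymbol\phi\,d\tau<\infty$. $\mathsf{Sy}(X)=X+X^\top$; $\otimes$: Kronecker product; $\mathbb S^n$: real symmetric matrices, $\mathbb S^n_{\succ0}$ the positive definite ones. *)

(* Defs.v *)
From HB Require Import structures.
From mathcomp Require Import all_boot all_order all_algebra.
From mathcomp Require Import all_classical all_reals all_analysis.
From mathcomp Require Import sesquilinear mxtens.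

Set Implicit Arguments.
Unset Strict Implicit.
Unset Printing Implicit Defensive.

Import Order.TTheory GRing.Theory Num.Theory.
Import numFieldNormedType.Exports.

Local Open Scope classical_set_scope.
Local Open Scope ring_scope.

(* R with the sigma-algebra of Lebesgue (not only Borel) measurable sets, the
   domain of completed_lebesgue_measure. *)
Notation lebesgueType R :=
  (caratheodory_type (mu_ext (wlength (@idfun (Real.sort R))))).

(* Lebesgue measure theory on \bar R: +oo and -oo are null points, each of them
   measurable, so measurability, measure and integrals only see the finite part
   of a set. *)
Section ExtendedLine.
Context {R : realType}.
Implicit Types (K : set (\bar R)) (g : \bar R -> R).

Definition fin_part K : set (lebesgueType R) := [set t : R | K t%:E].

Definition lebesgue_measurable K : Prop := measurable (fin_part K).

Definition ext_lebesgue_measure K : \bar R :=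
  completed_lebesgue_measure (fin_part K).

Definition lebesgue_measurable_fun K g : Prop :=
  measurable_fun (fin_part K) (fun t : lebesgueType R => g (t : R)%:E).

(* \bar R-valued; meant for nonnegative g *)
Definition eintegral K g : \bar R :=
  (\int[completed_lebesgue_measure]_(t in fin_part K) (g (t : R)%:E)%:E)%E.

Definition rintegral K g : R :=
  \int[completed_lebesgue_measure]_(t in fin_part K) g (t : R)%:E.

Definition mxintegral m n K (A : \bar R -> 'M[R]_(m, n)) : 'M[R]_(m, n) :=
  \matrix_(i, j) rintegral K (fun t => A t i j).

(* Functions are total on \bar R; only their values on K matter. *)
Definition L2w K (w : \bar R -> R) d (phi : \bar R -> 'cV[R]_d) : Prop :=
  (forall i, lebesgue_measurable_fun K (fun t => phi t i 0)) /\
  (eintegral K (fun t => w t * ((phi t)^T *m phi t) 0 0)%R < +oo)%E.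

End ExtendedLine.

Section Matrices.
Context {R : realType}.

Definition posdefmx n (A : 'M[R]_n) : Prop :=
  A \is symmetricmx /\
  forall v : 'cV[R]_n, v != 0 -> 0 < (v^T *m A *m v) 0 0.

Definition possemidefmx n (A : 'M[R]_n) : Prop :=
  A \is symmetricmx /\
  forall v : 'cV[R]_n, 0 <= (v^T *m A *m v) 0 0.

Definition Sy n (A : 'M[R]_n) : 'M[R]_n := A + A^T.

(* Kronecker products of f and of f^T with I_m; the casts only replace 1 * m by m. *)
Definition kronI m d (f : 'cV[R]_d) : 'M[R]_(d * m, m) :=
  castmx (erefl, mul1n m) (f *t (1%:M : 'M[R]_m)).

Definition trkronI m d (f : 'cV[R]_d) : 'M[R]_(m, d * m) :=
  castmx (mul1n m, erefl) (f^T *t (1%:M : 'M[R]_m)).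

Lemma sum_ord_const (d m : nat) : (\sum_(i < d) m)%N = (d * m)%N.
Proof. by rewrite sum_nat_const card_ord. Qed.

(* [X_1 ... X_d] and the vertical stacking of X_1, ..., X_d *)
Definition hcat d m p (X : 'I_d -> 'M[R]_(m, p)) : 'M[R]_(m, d * p) :=
  castmx (erefl, sum_ord_const d p) (\mxrow_(i < d) X i).

Definition vcat d m p (X : 'I_d -> 'M[R]_(m, p)) : 'M[R]_(d * m, p) :=
  castmx (sum_ord_const d m, erefl) (\mxcol_(i < d) X i).

End Matrices.

(* Main.v *)
Require Import Defs.
From mathcomp Require Import all_boot all_order all_algebra.
From mathcomp Require Import all_classical all_reals all_analysis.
From mathcomp Require Import measurable_realfun ring lra.
From mathcomp Require Import sesquilinear mxtens.

Set Implicit Arguments.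
Unset Strict Implicit.
Unset Printing Implicit Defensive.

Import Order.TTheory GRing.Theory Num.Theory.

Local Open Scope classical_set_scope.
Local Open Scope ring_scope.

(** Fix a point [t] of [K] and test the positive semidefinite block matrix on
    the vector [v] stacking [x t] over [(f t (x) I_(rho n)) z].  Expanding
    [v^T M v >= 0] gives
      [x^T U x - x^T [X_1 ... X_d] (f (x) I) z - transpose
         + z^T (f^T (x) I) Y (f (x) I) z >= 0].
    The one algebraic fact behind the theorem is that the Kronecker factor can
    be moved across the row of blocks, turning it into a column of blocks:
      [[X_1 ... X_d] (f (x) I_(rho n)) = \sum_i f_i X_i = (f (x) I_n)^T Xhat]
    ([hcat_mul_kronI]).  The cross terms thus become
    [- (Xhat z)^T (F x)] and its transpose, in which the only dependence on
    [t] besides the constant vector [Xhat z] is through [F x].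

    Multiplying by the weight and integrating keeps the sign.  The integral of
    [w F x] is [Upsilon z] by assumption, so the cross terms integrate to
    [- z^T Sy(Upsilon^T Xhat) z], and the last term to [z^T W z]; rearranging
    yields the inequality.

    Integrating term by term requires every term to be integrable.  Each is a
    constant-coefficient combination of products [w g h] with [g] and [h]
    among [0] and the entries of [f] and [x]; the entries are square
    integrable for the weight, and [w |g h| <= w g^2 + w h^2]
    ([weighted_mul_integrable], [mxintegrable_weighted_form]). *)

(** * Block rows, block columns and Kronecker products with the identity *)

Section BlockAlgebra.
Context {R : realType}.

(** The row [a] of the block [i] of a stack has the index [i * m + a], which is
    also the index that the Kronecker product gives to the pair [(i, a)]; this
    is what makes the two block structures compatible. *)
Lemma vcatE d m p (X : 'I_d -> 'M[R]_(m, p)) i a b :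
  vcat X (mxtens_index (i, a)) b = X i a b.
Proof.
rewrite castmxE/= cast_ord_id.
set k := cast_ord _ _.
have -> : k = tagnat.Rank i a.
  apply/val_inj; rewrite [RHS]tagnat.RankEsum/=.
  by rewrite (big_ord_narrow (ltnW (ltn_ord i))) sum_nat_const card_ord.
by have /matrixP/(_ a b) := mxcolK X i; rewrite mxE.
Qed.

Lemma trkronIE m d (f : 'cV[R]_d) : trkronI m f = (kronI m f)^T.
Proof. by rewrite /trkronI /kronI trmx_cast/= trmx_tens trmx1. Qed.

Lemma kronIE m d (f : 'cV[R]_d) i (a b : 'I_m) :
  kronI m f (mxtens_index (i, a)) b = f i 0 *+ (a == b).
Proof.
rewrite castmxE/= cast_ord_id.
have -> : cast_ord (esym (mul1n m)) b = mxtens_index (ord0 : 'I_1, b).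
  by apply/val_inj; rewrite /= mul0n.
by rewrite tensmxE mxE mulr_natr.
Qed.

(** Seeing [f (x) I] as a stack of scalar matrices reduces its products with
    block rows and block columns to blockwise multiplication. *)
Lemma kronI_vcat m d (f : 'cV[R]_d) : kronI m f = vcat (fun i => (f i 0)%:M).
Proof.
apply/matrixP => k b; case: (mxtens_indexP k) => i a.
by rewrite kronIE vcatE mxE.
Qed.

Lemma tr_vcat d m p (X : 'I_d -> 'M[R]_(m, p)) :
  (vcat X)^T = hcat (fun i => (X i)^T).
Proof. by rewrite /vcat trmx_cast/= tr_mxcol. Qed.

Lemma mul_hcat_vcat d m p q (A : 'I_d -> 'M[R]_(m, p))
    (B : 'I_d -> 'M[R]_(p, q)) :
  hcat A *m vcat B = \sum_i A i *m B i.
Proof.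
rewrite /hcat /vcat -mul_mxrow_mxcol.
by case: _ / (sum_ord_const d p); rewrite !castmx_id.
Qed.

(** Scalar matrices commute with the blocks, so both sides are
    [\sum_i f_i X_i]; note the change of size of the identity, from [m] on the
    left to [n] on the right. *)
Lemma hcat_mul_kronI n m d (f : 'cV[R]_d) (X : 'I_d -> 'M[R]_(n, m)) :
  hcat X *m kronI m f = (kronI n f)^T *m vcat X.
Proof.
rewrite !kronI_vcat tr_vcat !mul_hcat_vcat; apply: eq_bigr => i _.
by rewrite tr_scalar_mx scalar_mxC.
Qed.

Lemma block_quad_form n m (U : 'M[R]_n) (H : 'M[R]_(n, m)) (Y : 'M[R]_m)
    (x : 'cV[R]_n) (y : 'cV[R]_m) :
  (col_mx x y)^T *m block_mx U (- H) (- H^T) Y *m col_mx x y =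
  x^T *m U *m x - x^T *m H *m y - (x^T *m H *m y)^T + y^T *m Y *m y.
Proof.
rewrite tr_col_mx mul_row_block mul_row_col !mulmxDl !mulmxN !mulNmx.
rewrite !trmx_mul trmxK !mulmxA !addrA; congr (_ + _).
by rewrite addrAC.
Qed.

(** The pointwise identity that gets integrated: the test vector is chosen so
    that the cross terms involve [z] only through the constant [vcat X *m z],
    and the last term is the integrand of [W]. *)
Lemma block_form_kronI n p d (U : 'M[R]_n) (X : 'I_d -> 'M[R]_(n, p))
    (Y : 'M[R]_(d * p)) (f : 'cV[R]_d) (x : 'cV[R]_n) (z : 'cV[R]_p) :
  let v := col_mx x (kronI p f *m z) in
  let b := (vcat X *m z)^T *m (kronI n f *m x) in
  v^T *m block_mx U (- hcat X) (- (hcat X)^T) Y *m v =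
  x^T *m U *m x - b - b^T + z^T *m (trkronI p f *m Y *m kronI p f) *m z.
Proof.
move=> v b.
have bE : x^T *m hcat X *m (kronI p f *m z) = b^T.
  by rewrite /b !trmx_mul !trmxK !mulmxA -(mulmxA x^T) hcat_mul_kronI !mulmxA.
rewrite /v block_quad_form bE trmxK trkronIE (trmx_mul (kronI p f) z) !mulmxA.
by rewrite (addrAC _ (- b^T)).
Qed.

End BlockAlgebra.

(** * Linearity of the matrix integral *)

Section MatrixIntegral.
Context {R : realType} {K : set (\bar R)}.
Hypothesis K_meas : lebesgue_measurable K.

Definition integrable_on (g : \bar R -> R) : Prop :=
  (@completed_lebesgue_measure R).-integrable (fin_part K)
    (fun t : lebesgueType R => (g (t : R)%:E)%:E).

Definition mxintegrable m n (A : \bar R -> 'M[R]_(m, n)) : Prop :=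
  forall i j, integrable_on (fun t => A t i j).

Lemma integrable_onD g h :
  integrable_on g -> integrable_on h -> integrable_on (fun t => g t + h t).
Proof. by move=> ig ih; apply: (integrableD _ ig ih). Qed.

Lemma integrable_onZ c g : integrable_on g -> integrable_on (fun t => c * g t).
Proof. by move=> ig; apply: (integrableZl _ _ ig). Qed.

Lemma integrable_on_sum I (s : seq I) (g : I -> \bar R -> R) :
  (forall i, integrable_on (g i)) ->
  integrable_on (fun t => \sum_(i <- s) g i t).
Proof.
move=> ig; elim: s => [|i s IHs].
  rewrite /integrable_on; under eq_fun do rewrite big_nil; exact: integrable0.
rewrite /integrable_on; under eq_fun do rewrite big_cons.
exact: (integrable_onD (ig i) IHs).
Qed.

Lemma rintegralD g h : integrable_on g -> integrable_on h ->
  rintegral K (fun t => g t + h t) = rintegral K g + rintegral K h.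
Proof. by move=> ig ih; apply: RintegralD. Qed.

Lemma rintegralZ c g : integrable_on g ->
  rintegral K (fun t => c * g t) = c * rintegral K g.
Proof. by move=> ig; apply: RintegralZl. Qed.

Lemma rintegral_sum I (s : seq I) (g : I -> \bar R -> R) :
  (forall i, integrable_on (g i)) ->
  rintegral K (fun t => \sum_(i <- s) g i t) = \sum_(i <- s) rintegral K (g i).
Proof.
move=> ig; elim: s => [|i s IHs].
  rewrite big_nil /rintegral; under eq_Rintegral do rewrite big_nil.
  by rewrite Rintegral_cst// mul0r.
rewrite big_cons -IHs -rintegralD//; last exact: integrable_on_sum.
by congr rintegral; apply/funext => t; rewrite big_cons.
Qed.

Lemma mxintegrableD m n (A B : \bar R -> 'M[R]_(m, n)) :
  mxintegrable A -> mxintegrable B -> mxintegrable (fun t => A t + B t).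
Proof.
move=> iA iB i j; rewrite /integrable_on; under eq_fun do rewrite mxE.
exact: (integrable_onD (iA i j) (iB i j)).
Qed.

Lemma mxintegrableN m n (A : \bar R -> 'M[R]_(m, n)) :
  mxintegrable A -> mxintegrable (fun t => - A t).
Proof.
move=> iA i j; rewrite /integrable_on; under eq_fun do rewrite mxE -mulN1r.
exact: (integrable_onZ _ (iA i j)).
Qed.

Lemma mxintegrable_tr m n (A : \bar R -> 'M[R]_(m, n)) :
  mxintegrable A -> mxintegrable (fun t => (A t)^T).
Proof.
move=> iA i j; rewrite /integrable_on; under eq_fun do rewrite mxE.
exact: iA.
Qed.

Lemma mxintegrableMl m n p (P : 'M[R]_(p, m)) (A : \bar R -> 'M[R]_(m, n)) :
  mxintegrable A -> mxintegrable (fun t => P *m A t).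
Proof.
move=> iA i j; rewrite /integrable_on; under eq_fun do rewrite mxE.
apply: (@integrable_on_sum _ _ (fun k t => P i k * A t k j)) => k.
exact: integrable_onZ.
Qed.

Lemma mxintegralD m n (A B : \bar R -> 'M[R]_(m, n)) :
  mxintegrable A -> mxintegrable B ->
  mxintegral K (fun t => A t + B t) = mxintegral K A + mxintegral K B.
Proof.
move=> iA iB; apply/matrixP => i j; rewrite !mxE -rintegralD//.
by congr rintegral; apply/funext => t; rewrite mxE.
Qed.

Lemma mxintegralN m n (A : \bar R -> 'M[R]_(m, n)) : mxintegrable A ->
  mxintegral K (fun t => - A t) = - mxintegral K A.
Proof.
move=> iA; apply/matrixP => i j; rewrite !mxE -mulN1r -rintegralZ//.
by congr rintegral; apply/funext => t; rewrite mxE mulN1r.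
Qed.

Lemma mxintegral_tr m n (A : \bar R -> 'M[R]_(m, n)) :
  mxintegral K (fun t => (A t)^T) = (mxintegral K A)^T.
Proof.
apply/matrixP => i j; rewrite !mxE.
by congr rintegral; apply/funext => t; rewrite mxE.
Qed.

Lemma mxintegralMl m n p (P : 'M[R]_(p, m)) (A : \bar R -> 'M[R]_(m, n)) :
  mxintegrable A -> mxintegral K (fun t => P *m A t) = P *m mxintegral K A.
Proof.
move=> iA; apply/matrixP => i j; rewrite !mxE.
under [RHS]eq_bigr do rewrite mxE -rintegralZ//.
rewrite -rintegral_sum; last by move=> k; exact: integrable_onZ.
by congr rintegral; apply/funext => t; rewrite mxE.
Qed.

Lemma mxintegrableMr m n p (A : \bar R -> 'M[R]_(m, n)) (Q : 'M[R]_(n, p)) :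
  mxintegrable A -> mxintegrable (fun t => A t *m Q).
Proof.
move=> /mxintegrable_tr/(mxintegrableMl Q^T)/mxintegrable_tr.
by under eq_fun do rewrite trmx_mul !trmxK.
Qed.

Lemma mxintegralMr m n p (A : \bar R -> 'M[R]_(m, n)) (Q : 'M[R]_(n, p)) :
  mxintegrable A -> mxintegral K (fun t => A t *m Q) = mxintegral K A *m Q.
Proof.
move=> /mxintegrable_tr iA; apply: trmx_inj.
rewrite trmx_mul -!mxintegral_tr -mxintegralMl//.
by congr mxintegral; apply/funext => t; rewrite trmx_mul.
Qed.

End MatrixIntegral.

Arguments integrable_on {R} K g.
Arguments mxintegrable {R} K {m n} A.

(** * Integrability of weighted products *)

Section WeightedL2.
Context {R : realType} {K : set (\bar R)} {w : \bar R -> R}.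
Hypothesis K_meas : lebesgue_measurable K.
Hypothesis w_ge0 : forall t, K t -> 0 <= w t.
Hypothesis w_meas : lebesgue_measurable_fun K w.

(** Entrywise form of [L2w]: unlike [L2w], which bounds the sum of the squares
    of the entries of a column, it can be asked of any single entry of a matrix
    function such as [kronI m (f t)]. *)
Definition square_integrable (g : \bar R -> R) : Prop :=
  lebesgue_measurable_fun K g /\ integrable_on K (fun t => w t * g t ^+ 2).

Lemma weighted_mul_integrable g h : square_integrable g -> square_integrable h ->
  integrable_on K (fun t => w t * (g t * h t)).
Proof.
move=> [mg ig] [mh ih].
apply: (le_integrable _ _ _ (integrableD _ ig ih)) => //.
  by apply/measurable_EFinP; do 2 apply: measurable_funM => //.
move=> t Kt /=; rewrite lee_fin; have wt := w_ge0 Kt.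
rewrite -mulrDr !normrM (ger0_norm wt) ler_wpM2l// -normrM.
(* |a b| <= a^2 + b^2 *)
set a := g _; set b := h _.
rewrite [leRHS]ger0_norm ?addr_ge0 ?sqr_ge0//.
rewrite ler_norml; apply/andP; split; nra.
Qed.

(** One square is dominated by the sum of all of them. *)
Lemma L2w_square_integrable d (phi : \bar R -> 'cV[R]_d) i :
  L2w K w phi -> square_integrable (fun t => phi t i 0).
Proof.
move=> [mphi fin]; split => //.
have sqE t : ((phi t)^T *m phi t) 0 0 = \sum_k phi t k 0 ^+ 2.
  by rewrite mxE; apply: eq_bigr => k _; rewrite mxE expr2.
have msq k : lebesgue_measurable_fun K (fun t => phi t k 0 ^+ 2).
  exact: (measurable_funX 2 (mphi k)).
apply: (@le_integrable _ _ _ _ _ K_meas _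
    (fun t : lebesgueType R =>
      (w t%:E * ((phi t%:E)^T *m phi t%:E) 0 0)%:E)).
- by apply/measurable_EFinP; exact: (measurable_funM w_meas (msq i)).
- move=> t Kt /=; rewrite lee_fin sqE; have wt := w_ge0 Kt.
  have s0 (P : pred 'I_d) : 0 <= \sum_(k | P k) phi t%:E k 0 ^+ 2.
    by apply: sumr_ge0 => k _; exact: sqr_ge0.
  rewrite (ger0_norm (mulr_ge0 wt (sqr_ge0 _))).
  rewrite (ger0_norm (mulr_ge0 wt (s0 predT))).
  by rewrite ler_wpM2l// (bigD1 i)//= lerDl.
- apply/integrableP; split.
    apply/measurable_EFinP; under eq_fun do rewrite sqE.
    by apply: measurable_funM => //; exact: measurable_sum.
  apply: le_lt_trans fin; rewrite le_eqVlt; apply/orP; left; apply/eqP.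
  apply: eq_integral => t; rewrite inE => Kt /=.
  rewrite ger0_norm// mulr_ge0//; first exact: w_ge0.
  by rewrite sqE sumr_ge0// => k _; exact: sqr_ge0.
Qed.

Lemma square_integrable0 : square_integrable (fun=> 0).
Proof.
split; first exact: measurable_cst.
rewrite /integrable_on; under eq_fun do rewrite expr0n/= mulr0.
exact: integrable0.
Qed.

Lemma kronI_square_integrable m d (f : \bar R -> 'cV[R]_d) k b :
  L2w K w f -> square_integrable (fun t => kronI m (f t) k b).
Proof.
move=> fL2; case: (mxtens_indexP k) => i a.
under eq_fun do rewrite kronIE.
case: (a == b); last exact: square_integrable0.
exact: L2w_square_integrable.
Qed.

(** The common shape of the three integrands [x^T U x], [F x] and
    [(f^T (x) I) Y (f (x) I)]. *)
Lemma mxintegrable_weighted_form m n p q (A : \bar R -> 'M[R]_(p, m)) (M : 'M[R]_(p, q))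
    (B : \bar R -> 'M[R]_(q, n)) :
  (forall i j, square_integrable (fun t => A t i j)) ->
  (forall i j, square_integrable (fun t => B t i j)) ->
  mxintegrable K (fun t => w t *: ((A t)^T *m M *m B t)).
Proof.
move=> sA sB i j.
rewrite (_ : (fun t => _) = fun t =>
    \sum_l \sum_k M k l * (w t * (A t k i * B t l j))).
  do 2 apply: integrable_on_sum => // ?.
  by apply: integrable_onZ => //; exact: weighted_mul_integrable.
apply/funext => t; rewrite !mxE mulr_sumr; apply: eq_bigr => l _.
rewrite !mxE mulr_suml mulr_sumr; apply: eq_bigr => k _.
by rewrite mxE; ring.
Qed.

End WeightedL2.

Theorem theorem4p3 (R : realType) (K : set (\bar R)) (w : \bar R -> R)
    (n d rho : nat) (U : 'M[R]_n) (f : \bar R -> 'cV[R]_d)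
    (K_meas : lebesgue_measurable K)
    (K_neq0 : ext_lebesgue_measure K <> 0%E)
    (w_ge0 : forall t, K t -> 0 <= w t)
    (w_meas : lebesgue_measurable_fun K w)
    (w_zeros : countable [set t | K t /\ w t = 0])
    (U_pos : posdefmx U)
    (f_L2 : L2w K w f)
    (f_gram : posdefmx (mxintegral K (fun t => w t *: (f t *m (f t)^T))))
    (Y : 'M[R]_(d * (rho * n))) (X : 'I_d -> 'M[R]_(n, rho * n))
    (Y_sym : Y \is symmetricmx)
    (UXY : possemidefmx (block_mx U (- hcat X) (- (hcat X)^T) Y)) :
  let F := fun t => kronI n (f t) in
  let W := mxintegral K (fun t =>
    w t *: (trkronI (rho * n) (f t) *m Y *m kronI (rho * n) (f t))) in
  let Xhat := vcat X in
  forall x : \bar R -> 'cV[R]_n, L2w K w x ->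
  forall (Upsilon : 'M[R]_(d * n, rho * n)) (z : 'cV[R]_(rho * n)),
    Upsilon *m z = mxintegral K (fun t => w t *: (F t *m x t)) ->
    (z^T *m (Sy (Upsilon^T *m Xhat) - W) *m z) 0 0
      <= rintegral K (fun t => w t * ((x t)^T *m U *m x t) 0 0).
Proof.
move=> F W Xhat x xL2 Upsilon z UpsilonE.
have sx i j : square_integrable (K := K) (w := w) (fun t => x t i j).
  by rewrite [j]ord1; exact: L2w_square_integrable.
have sF m i j : square_integrable (K := K) (w := w)
    (fun t => kronI m (f t) i j).
  exact: kronI_square_integrable.
set c := Xhat *m z.
pose A t := w t *: ((x t)^T *m U *m x t).
pose H t := w t *: (F t *m x t).
pose G t := w t *: (trkronI (rho * n) (f t) *m Y *m kronI (rho * n) (f t)).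
have iA : mxintegrable K A by exact: mxintegrable_weighted_form.
have iH : mxintegrable K H.
  (* F x is read as (F^T)^T 1 x *)
  have sFT i j : square_integrable (K := K) (w := w) (fun t => (F t)^T i j).
    by under eq_fun do rewrite mxE; exact: sF.
  have := mxintegrable_weighted_form K_meas w_ge0 w_meas 1%:M sFT sx.
  by under eq_fun do rewrite trmxK mulmx1.
have iG : mxintegrable K G.
  rewrite /G; under eq_fun do rewrite trkronIE.
  exact: (mxintegrable_weighted_form K_meas w_ge0 w_meas Y (sF _) (sF _)).
pose Q t := A t - c^T *m H t - (c^T *m H t)^T + z^T *m G t *m z.
(* [Q] is the weighted block form, written so that it integrates termwise. *)
have QE t : Q t = w t *:
    ((col_mx (x t) (kronI (rho * n) (f t) *m z))^T
     *m block_mx U (- hcat X) (- (hcat X)^T) Y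
     *m col_mx (x t) (kronI (rho * n) (f t) *m z)).
  rewrite block_form_kronI !scalerDr !scalerN -/c /Q /A /H /G.
  by rewrite -!scalemxAr -scalemxAl [(_ *: _)^T]linearZ.
have Q_ge0 : 0 <= (mxintegral K Q) 0 0.
  rewrite mxE; apply: Rintegral_ge0 => t Kt; rewrite QE mxE.
  by rewrite mulr_ge0 ?w_ge0//; have [_] := UXY; exact.
have ic := mxintegrableMl K_meas c^T iH.
have QintE : mxintegral K Q = mxintegral K A
    - z^T *m Sy (Upsilon^T *m Xhat) *m z + z^T *m W *m z.
  have icN := mxintegrableN K_meas ic.
  have ictN := mxintegrableN K_meas (mxintegrable_tr ic).
  have iAc := mxintegrableD K_meas iA icN.
  have iGz := mxintegrableMl K_meas z^T iG.
  rewrite /Q mxintegralD//; [|exact: mxintegrableD|exact: mxintegrableMr].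
  rewrite mxintegralMr// mxintegralMl// mxintegralD// mxintegralD//.
  rewrite !mxintegralN//; last exact: mxintegrable_tr.
  rewrite mxintegral_tr mxintegralMl// -[mxintegral K H]UpsilonE.
  rewrite /Sy mulmxDr mulmxDl /c !trmx_mul !trmxK !mulmxA opprD addrA.
  by rewrite (addrAC (mxintegral K A)).
have AE : rintegral K (fun t => w t * ((x t)^T *m U *m x t) 0 0) =
    (mxintegral K A) 0 0.
  by rewrite [RHS]mxE; congr rintegral; apply/funext => t; rewrite [RHS]mxE.
move: Q_ge0; rewrite AE QintE mulmxBr mulmxBl !mxE.
lra.
Qed.
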